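(* For all $m\ge0$, (i) $\displaystyle \mathfrak M_{[2m+1];1}(x)=\frac{x}{U_m^2\left(\frac1{2x}\right)}$; (ii) $\displaystyle \mathfrak M_{[2m+2];1}(x)=\frac{x^2R_{m+1}^2(x^2)}{\bigl(1+x^2R_{m+1}^2(x^2)\bigr)^2U_m^2\left(\frac1{2x}\right)}\Bigl(1+2xR_{m+1}(x^2)-x^2R_{m+1}^2(x^2)\Bigr)$.
   Context: $\mathfrak S_n$ is the set of permutations of $\{1,\dots,n\}$. An occurrence of a pattern $\tau\in\mathfrak S_k$ in $\pi$ is a choice of positions $i_1<\dots<i_k$ such that $(\pi_{i_1},\dots,\pi_{i_k})$ is order-isomorphic to $\tau$; $\pi$ avoids $\tau$ if there is none, and contains $\tau$ exactly $r$ times if there are exactly $r$ occurrences. $[k]$ denotes the pattern $12\ldots k$. $\mathfrak M_{\tau;1}(x)=\sum_{n\ge0}(e_{\tau;1}(n)-o_{\tau;1}(n))x^n$, where $e_{\tau;1}(n)$ (resp. $o_{\tau;1}(n)$) is the number of even (resp. odd) $132$-avoiding permutations in $\mathfrak S_n$ that contain $\tau$ exactly once. $U_r$ is the Chebyshev polynomial of the second kind: $U_0(t)=1$, $U_1(t)=2t$, $U_r(t)=2tU_{r-1}(t)-U_{r-2}(t)$; $U_r^2(t)=(U_r(t))^2$. For $k\ge1$, $R_k(x)=\dfrac{U_{k-1}\left(\frac1{2\sqrt x}\right)}{\sqrt x\,U_k\left(\frac1{2\sqrt x}\right)}$, a rational function of $x$ (so $R_1(x)=1$, $R_k(x)=1/(1-xR_{k-1}(x))$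 for $k\ge2$), and $R_k^2(x^2)=(R_k(x^2))^2$. *)

(* Defs.v *)
From HB Require Import structures.
From mathcomp Require Import all_boot all_order all_fingroup all_algebra.

Set Implicit Arguments.
Unset Strict Implicit.
Unset Printing Implicit Defensive.

Import GRing.Theory.
Local Open Scope ring_scope.

(* A permutation s : 'S_n is read as the word (s 0) (s 1) ... (s (n - 1));
   positions and letters are numbered from 0 instead of 1. *)

(* Positions i_1 < ... < i_k are encoded as a strictly increasing map from
   'I_k to 'I_n, so that distinct occurrences are distinct maps. *)
Definition occurrences (k n : nat) (tau : 'S_k) (s : 'S_n) :
    {set {ffun 'I_k -> 'I_n}} :=
  [set f : {ffun 'I_k -> 'I_n} |
    [forall a : 'I_k, forall b : 'I_k, (a < b)%N ==> (f a < f b)%N] &&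
    [forall a : 'I_k, forall b : 'I_k,
       (s (f a) < s (f b))%N == (tau a < tau b)%N]].

Definition avoids (k n : nat) (tau : 'S_k) (s : 'S_n) : bool :=
  occurrences tau s == set0.

Definition contains_exactly (k n : nat) (tau : 'S_k) (r : nat) (s : 'S_n) :
    bool :=
  #|occurrences tau s| == r.

(* The word 132 (i.e. 021 when numbered from 0) swaps the last two letters. *)
Definition p132 : 'S_3 := tperm (inord 1) (inord 2).

Definition incr_pattern (k : nat) : 'S_k := perm_one 'I_k.

Definition even_count (k : nat) (tau : 'S_k) (r n : nat) : nat :=
  #|[set s : 'S_n | [&& avoids p132 s, contains_exactly tau r s
                      & ~~ odd_perm s]]|.

Definition odd_count (k : nat) (tau : 'S_k) (r n : nat) : nat :=
  #|[set s : 'S_n | [&& avoids p132 s, contains_exactly tau r s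
                      & odd_perm s]]|.

(* A formal power series is given by its sequence of coefficients. *)
Definition series := nat -> rat.

Definition series_of_poly (p : {poly rat}) : series := fun n => p`_n.

Definition series_mul (a b : series) : series :=
  fun n => \sum_(i < n.+1) a i * b (n - i)%N.

Definition Mgf (k : nat) (tau : 'S_k) (r : nat) : series :=
  fun n => (even_count tau r n)%:R - (odd_count tau r n)%:R.

Notation ratfun := {fraction {poly rat}}.

Definition ratx : ratfun := tofrac 'X.

(* The equality a = f between a power series and a rational function: it holds
   when q * a = p for a fraction p / q representing f. As rat[[x]] has no zero
   divisors, the choice of p / q is irrelevant, at most one series a expands a
   given f, and none does if f has a pole at 0. *)
Definition expands (a : series) (f : ratfun) : Prop :=
  exists p q : {poly rat},
    [/\ q != 0, f = tofrac p / tofrac q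
      & series_mul (series_of_poly q) a =1 series_of_poly p].

Fixpoint chebU (R : nzRingType) (r : nat) : {poly R} :=
  match r with
  | 0 => 1
  | 1 => 'X *+ 2
  | (r'.+1 as r1).+1 => 'X *+ 2 * chebU R r1 - chebU R r'
  end.

(* [chebR k y] is R_k(y ^ 2), that is, R_k written in terms of a square root y
   of its argument; only k >= 1 is meaningful. The choice of the square root
   does not matter, by [chebR1] and [chebRS]; in particular R_k(x ^ 2) is
   [chebR k ratx]. *)
Definition chebR (F : fieldType) (k : nat) (y : F) : F :=
  (chebU F k.-1).[1 / (2%:R * y)] / (y * (chebU F k).[1 / (2%:R * y)]).

Lemma chebR1 (F : fieldType) (y : F) :
  2%:R != 0 :> F -> y != 0 -> chebR 1 y = 1.
Proof.
move=> h2 hy; rewrite /chebR /= hornerMn hornerX hornerC.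
have -> : 1 / (2%:R * y) *+ 2 = y^-1.
  by rewrite div1r -mulr_natl invfM mulrA divff // mul1r.
by rewrite divff // divr1.
Qed.

Lemma chebRS (F : fieldType) (k : nat) (y : F) :
  2%:R != 0 :> F -> y != 0 -> (0 < k)%N ->
  (chebU F k).[1 / (2%:R * y)] != 0 ->
  chebR k.+1 y = 1 / (1 - y ^+ 2 * chebR k y).
Proof.
case: k => // k h2 hy _; rewrite /chebR /=.
set u := 1 / (2%:R * y).
have hu : u *+ 2 = y^-1.
  by rewrite /u div1r -mulr_natl invfM mulrA divff // mul1r.
rewrite hornerD hornerN hornerM hornerMn hornerX hu.
set U1 := (match k with 0 => _ | _ => _ end).[u]; set U0 := (chebU F k).[u].
move=> hU; rewrite [RHS]div1r mulrBr mulrA divff // mul1r.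
have -> : 1 - y ^+ 2 * (U0 / (y * U1)) = (U1 - y * U0) / U1.
  rewrite mulrBl divff // expr2 invfM; congr (_ - _).
  by rewrite -!mulrA; congr (_ * _); rewrite mulrCA mulVKf.
by rewrite invfM invrK mulrC.
Qed.

(* Main.v *)
Require Import Defs.
From HB Require Import structures.
From mathcomp Require Import all_boot all_order all_fingroup all_algebra.
From mathcomp Require Import boolp.
From mathcomp Require Import zify ring.
Set Implicit Arguments.
Unset Strict Implicit.
Unset Printing Implicit Defensive.
Import GRing.Theory.

(** A nonempty 132-avoiding word has the form u' N v, where N is its largest
letter, every letter of u' exceeds every letter of v, and u', v avoid 132. The
increasing subsequences of length k >= 1 of u' N v are those of u', those of v,
and those of length k - 1 of u' completed by N. If u' and v have i and j
letters, there are j(i + 1) inversions besides those inside u' and v. A word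
with at most one increasing subsequence of length k - 1 >= 1 has none of length
k; so the signed generating functions A_k and B_k of the 132-avoiding
permutations that contain 12...k never, respectively once, satisfy recurrences
in k ([avoid_seriesS], [once_seriesS]) whose products are twisted by the sign
(-1)^(j(i+1)).

The sign depends only on the parities of i and j. Split every series into its
even and odd part and put z_k = even A_k + i odd A_k, w_k likewise from B_k,
with i^2 = -1. Multiplied by x, the twisted product of f and g then
becomes i x conj(f) g, and the recurrences read
    z_k = 1 + i x conj(z_(k-1)) z_k,
    w_k = i x (conj(w_(k-1)) z_k + conj(z_(k-1)) w_k),
that is, z_k = 1 / (1 - i x conj(z_(k-1))) and w_k = i x conj(w_(k-1)) z_k^2
([once_even], [once_odd]). Two steps of the first recurrence send
1 + i x R to 1 + i x / (1 - x^2 R), which gives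
    z_(2m+1) = 1 + i x R_m,     z_(2m+2) = R_(m+1) / (1 - i x R_(m+1)),
and therefore w_(2m+3) = x^2 R_(m+1)^2 w_(2m+1). Since w_1 = i x, both claims
follow, because B_k is the sum of the real and the imaginary part of w_k.

All of this is done without denominators. The polynomials
V_m = x^m U_m(1/(2x)) ([chebV]) satisfy V_(m+2) = V_(m+1) - x^2 V_m, have
constant term 1, and R_k(x^2) = V_(k-1) / V_k, so that the shape of z_k and
w_k can be stated as identities between products ([odd_shape], [even_shape])
and proved in any commutative ring where the V_m and a few similar elements
are cancellable ([shapes]). The ring used is that of formal power series, in
which every series with constant term 1 is cancellable ([fps_lreg]). *)

(** * Statistics of words and the decomposition at the largest letter *)

(** Counts the increasing subsequences of length [k] above the bound [b], which
is there to make the count recursive in [w]: after a letter it is replaced by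
this letter. For [b = 0] and positive letters it imposes nothing. *)
Fixpoint incr_count (k b : nat) (w : seq nat) : nat :=
  match k, w with
  | 0, _ => 1
  | k'.+1, [::] => 0
  | k'.+1, x :: w' => (if b < x then incr_count k' x w' else 0) + incr_count k b w'
  end.

Lemma incr_count0 b w : incr_count 0 b w = 1.
Proof. by case: w. Qed.

Lemma incr_count_small k b w : all (leq^~ b) w -> incr_count k.+1 b w = 0.
Proof. by elim: w => //= x w IH /andP[xb /IH ->]; rewrite ltnNge xb. Qed.

(** No increasing subsequence meets both [u] and [v], and one that ends in [N]
is made of [N] and a shorter one of [u]. The length is a successor because the
empty subsequence would be counted several times. *)
Lemma incr_count_glue k b N u v :
    b < N -> all (ltn^~ N) u -> all (ltn^~ N) v ->
    all (fun x => all (ltn^~ x) v) u ->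
  incr_count k.+1 b (u ++ N :: v)
  = incr_count k.+1 b u + incr_count k b u + incr_count k.+1 b v.
Proof.
move=> + + vN; elim: u k b => [|y u IH] k b bN /=.
  move=> _ _; rewrite bN; case: k => [|k]; first by rewrite !incr_count0.
  by rewrite incr_count_small //; apply: sub_all vN => x; apply: ltnW.
move=> /andP[yN uN] /andP[vy vu].
rewrite IH //; case: k => [|k]; first by rewrite !incr_count0; case: ifP => _; lia.
rewrite IH // (@incr_count_small _ y v); last by apply: sub_all vy => x /ltnW.
by rewrite /=; case: ifP => _; lia.
Qed.

Lemma incr_count_shift j k b u :
  incr_count k (j + b) (map (addn j) u) = incr_count k b u.
Proof. by elim: u k b => [|x u IH] [|k] b //=; rewrite ltn_add2l !IH. Qed.

Lemma incr_count_bound k b b' w :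
  all (ltn b) w -> all (ltn b') w -> incr_count k b w = incr_count k b' w.
Proof.
elim: w k => [|x w IH] [|k] //= /andP[bx bw] /andP[b'x b'w].
by rewrite bx b'x (IH k.+1).
Qed.

Lemma incr_count_anti k b b' w : b' <= b -> incr_count k b w <= incr_count k b' w.
Proof.
elim: w k => [|x w IH] [|k] //= b'b; apply: leq_add; last exact: IH.
by case: ltnP => // bx; rewrite (leq_ltn_trans b'b bx).
Qed.

(** An increasing subsequence of length [k + 1] contains [k + 1] of length [k].
So a word with no occurrence of 12...k, or with a single one (and k >= 1), has
none of 12...(k+1). *)
Lemma incr_count_pred k b w : 0 < incr_count k.+1 b w -> k < incr_count k b w.
Proof.
elim: w k b => [|x w IH] // [|k] b; first by rewrite incr_count0.
rewrite [X in X -> _]/= addn_gt0 => /orP[|/IH]; last by move=> /=; lia.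
case bx: (b < x) => //= /[dup] /IH; rewrite bx.
have := incr_count_anti k.+1 w (ltnW bx); lia.
Qed.

Lemma incr_count1 b w : all (ltn b) w -> incr_count 1 b w = size w.
Proof. by elim: w => //= x w IH /andP[-> /IH ->]; rewrite incr_count0. Qed.

Fixpoint inversions (w : seq nat) : nat :=
  if w is x :: w' then count (ltn^~ x) w' + inversions w' else 0.

Lemma inversions_shift j u : inversions (map (addn j) u) = inversions u.
Proof.
elim: u => //= x u ->; congr (_ + _); rewrite count_map.
by apply: eq_count => y /=; rewrite ltn_add2l.
Qed.

(** Besides the inversions inside [u] and [v], each letter of [v] is preceded by
[N] and by all of [u], which are larger. *)
Lemma inversions_glue N u v :
    all (ltn^~ N) u -> all (ltn^~ N) v -> all (fun x => all (ltn^~ x) v) u ->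
  inversions (u ++ N :: v)
    = inversions u + inversions v + size v * (size u).+1.
Proof.
move=> + vN; elim: u => [|x u IH] /=.
  by move=> _ _; move: vN; rewrite all_count => /eqP ->; lia.
move=> /andP[xN uN] /andP[vx vu]; rewrite IH // count_cat /=.
by move: vx; rewrite all_count => /eqP ->; rewrite ltnNge ltnW //=; lia.
Qed.

Fixpoint avoid132 (w : seq nat) : bool :=
  if w is x :: w' then
    pairwise (fun z y => ~~ ((x < y) && (y < z))) w' && avoid132 w'
  else true.

Lemma avoid132_shift j u : avoid132 (map (addn j) u) = avoid132 u.
Proof.
elim: u => //= x u ->; congr (_ && _); rewrite pairwise_map.
by apply: eq_pairwise => z y /=; rewrite !ltn_add2l.
Qed.

Lemma avoid132_cat u v : avoid132 (u ++ v) -> avoid132 u && avoid132 v.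
Proof.
elim: u => //= x u IH /andP[+ /IH /andP[-> ->]].
by rewrite pairwise_cat => /and3P[_ -> _].
Qed.

Lemma avoid132_glue N u v :
    all (ltn^~ N) u -> all (ltn^~ N) v -> all (fun x => all (ltn^~ x) v) u ->
  avoid132 (u ++ N :: v) = avoid132 u && avoid132 v.
Proof.
move=> + vN; elim: u => [|x u IH] /=.
  move=> _ _; rewrite (_ : pairwise _ v) //.
  elim: (v) vN => //= y w IH /andP[yN wN]; rewrite IH // andbT.
  by apply: sub_all wN => z /= zN; apply/negP => /andP[]; lia.
move=> /andP[xN uN] /andP[vx vu]; rewrite IH // andbA; congr (_ && _).
have small y : y \in v -> (x < y) = false.
  by move=> /(allP vx) /= yx; rewrite ltnNge ltnW.
congr (_ && _); rewrite pairwise_cat pairwise_cons.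
rewrite (_ : allrel _ _ _); last first.
  apply/allrelP => z y zu; rewrite inE => /predU1P[->|/small -> //].
  by have /= := allP uN _ zu; lia.
rewrite (_ : all _ _); last by apply/allP => y /small ->.
rewrite (_ : pairwise _ v) ?andbT //.
by apply/(pairwiseP 0) => i j _ jv _; rewrite small ?mem_nth.
Qed.

(** Letters [x] of [u] and [y] of [v] with x < y would make x N y an occurrence
of 132. *)
Lemma avoid132_split N u v :
  uniq (u ++ N :: v) -> all (leq^~ N) (u ++ N :: v) -> avoid132 (u ++ N :: v) ->
  all (fun x => all (ltn^~ x) v) u.
Proof.
elim: u => //= x u IH /andP[xn un] /andP[xN uN] /andP[+ av].
rewrite (IH un uN av) andbT pairwise_cat /= => /and4P[_ _ h _].
apply/allP => y yv; move/allP/(_ y yv): h => /=.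
move: xn; rewrite mem_cat inE => /norP[_ /norP[_ xv]].
have yx : y != x by apply: contraNneq xv => <-.
move: un; rewrite cat_uniq => /= /and3P[_ _ /andP[Nv _]].
have yN : y != N by apply: contraNneq Nv => <-.
move: uN; rewrite all_cat /= => /and3P[_ _ /allP/(_ y yv)].
move=> le; rewrite negb_and -leqNgt -leqNgt.
by move: le yx yN; rewrite /=; lia.
Qed.

(** * Permutations as words *)

(** An explicit list of the subsequences of given length, so that occurrences of
a pattern can be counted both by recursion and by bijection. *)
Fixpoint subseqs (T : Type) (k : nat) (w : seq T) : seq (seq T) :=
  match k, w with
  | 0, _ => [:: [::]]
  | k'.+1, [::] => [::]
  | k'.+1, x :: w' => map (cons x) (subseqs k' w') ++ subseqs k w'
  end.

Lemma subseqs_map (T S : Type) (f : T -> S) k w :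
  subseqs k (map f w) = map (map f) (subseqs k w).
Proof.
elim: w k => [|x w IH] [|k] //=; rewrite map_cat !IH -!map_comp //.
Qed.

Lemma mem_subseqs (T : eqType) k (w t : seq T) :
  (t \in subseqs k w) = (size t == k) && subseq t w.
Proof.
elim: w k t => [|x w IH] [|k] t.
- by rewrite inE; case: t.
- by case: t => [|y t]; rewrite ?andbF.
- by rewrite inE; case: t => //= y t; rewrite andbC.
rewrite [subseqs _ _]/= mem_cat; case: t => [|y t].
  by rewrite IH orbF /=; apply/mapP=> -[].
rewrite IH /= !eqSS.
case: (eqVneq y x) => [->|yx].
  rewrite mem_map ?IH; last by move=> ? ? [].
  case: (size t == k) => //=.
  by apply: orb_idr; apply: cons_subseq.
rewrite (_ : _ \in map _ _ = false) //; apply/mapP => -[? _ [xy]].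
by rewrite xy eqxx in yx.
Qed.

Lemma uniq_subseqs (T : eqType) k (w : seq T) : uniq w -> uniq (subseqs k w).
Proof.
elim: w k => [|x w IH] [|k] //= /andP[xw uw].
rewrite cat_uniq map_inj_uniq ?IH //=; last by move=> ? ? [].
rewrite andbT; apply/hasPn => t; rewrite mem_subseqs => /andP[_ tw].
apply/mapP => -[t' _ tE]; have := mem_subseq tw.
by rewrite tE => /(_ x (mem_head _ _)); rewrite (negbTE xw).
Qed.

Lemma incr_countE k b w : incr_count k b w = count (path ltn b) (subseqs k w).
Proof.
elim: w k b => [|x w IH] [|k] b //=.
rewrite count_cat count_map -(IH k.+1); congr (_ + _).
case bx: (b < x); first by rewrite IH; apply: eq_count => t /=; rewrite bx.
by rewrite (@eq_count _ _ pred0) ?count_pred0 // => t /=; rewrite bx.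
Qed.

Definition word n (s : 'S_n) : seq nat := [seq (val (s i)).+1 | i <- enum 'I_n].

Lemma size_word n (s : 'S_n) : size (word s) = n.
Proof. by rewrite size_map size_enum_ord. Qed.

Lemma nth_word n (s : 'S_n) (i : 'I_n) : nth 0 (word s) i = (s i).+1.
Proof. by rewrite (nth_map i) ?size_enum_ord // nth_ord_enum. Qed.

Lemma word_inj n : injective (@word n).
Proof.
move=> s t st; apply/permP => i; apply/val_inj/succn_inj.
by rewrite -!nth_word st.
Qed.

Lemma perm_word n (s : 'S_n) : perm_eq (word s) (iota 1 n).
Proof.
rewrite -[iota 1 n]/(iota (1 + 0) n) iotaDl -val_enum_ord -map_comp.
have -> : word s = map (fun i : 'I_n => (val i).+1) (map s (enum 'I_n)).
  by rewrite -map_comp.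
apply: perm_map; apply: uniq_perm.
- by rewrite map_inj_uniq ?enum_uniq //; apply: perm_inj.
- exact: enum_uniq.
move=> i; rewrite mem_enum; apply/mapP; exists (s^-1%g i);
  by rewrite ?mem_enum ?permKV.
Qed.

(** Distinct permutations have distinct words, and there are n! of both. *)
Lemma words_enum n :
  perm_eq (map (@word n) (enum [set: 'S_n])) (permutations (iota 1 n)).
Proof.
have u : uniq (map (@word n) (enum [set: 'S_n])).
  by rewrite map_inj_uniq ?enum_uniq //; apply: word_inj.
have sub : {subset map (@word n) (enum [set: 'S_n]) <= permutations (iota 1 n)}.
  by move=> _ /mapP[s _ ->]; rewrite mem_permutations perm_word.
apply: uniq_perm => //; first exact: permutations_uniq.
have [] := uniq_min_size u sub => //.
rewrite size_permutations ?iota_uniq // size_iota size_map -cardE cardsT.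
by rewrite card_Sn.
Qed.

(** Removing the first letter: the remaining ones are renumbered by closing the
gap left by it. *)
Lemma word_lift_perm0 n (x : 'I_n.+1) (s : 'S_n) :
  word (lift_perm ord0 x s) = x.+1 :: map (bump x.+1) (word s).
Proof.
rewrite /word enum_ordSl /= lift_perm_id; congr (_ :: _).
rewrite -!map_comp; apply: eq_map => i /=.
by rewrite lift_perm_lift /= bumpS.
Qed.

Lemma count_lt_perm n x w : x <= n.+1 -> perm_eq w (iota 1 n) ->
  count (ltn^~ x) w = x.-1.
Proof.
move=> xn /seq.permP ->.
elim: n xn => [|n IH]; first by case: x => [|[]].
rewrite leq_eqVlt => /predU1P[->|xn].
  rewrite (@eq_in_count _ _ predT) ?count_predT ?size_iota // => i.
  by rewrite mem_iota /=; lia.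
by rewrite -(addn1 n) iotaD count_cat IH //= add1n; lia.
Qed.

(** By induction on [n], removing the first letter: there are [s ord0] smaller
letters, all of them behind it, and [s ord0] is also what the first letter
contributes to the parity in [odd_lift_perm]. *)
Lemma odd_inversions_word n (s : 'S_n) : odd (inversions (word s)) = odd_perm s.
Proof.
elim: n s => [|n IH] s.
  have -> : s = 1%g by apply/permP => -[].
  by rewrite odd_perm1 /word enum_ord0.
pose x := s ord0.
pose f (i : 'I_n) := s (lift ord0 i).
have fx i : x != f i by rewrite (inj_eq perm_inj).
(* The default value is never used, since f i differs from x. *)
pose g i := odflt i (unlift x (f i)).
have gE i : lift x (g i) = f i.
  by rewrite /g; have := fx i; case: unliftP => //= -> ; rewrite eqxx.
have gi : injective g.
  move=> i j /(congr1 (lift x)); rewrite !gE => /perm_inj; exact: lift_inj.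
have -> : s = lift_perm ord0 x (perm gi).
  apply/permP => i; case: (unliftP ord0 i) => [j|] ->.
    by rewrite lift_perm_lift permE gE.
  by rewrite lift_perm_id.
set t := perm gi.
rewrite odd_lift_perm -IH word_lift_perm0 /= oddD count_map.
rewrite (@eq_count _ _ (ltn^~ x.+1)); last first.
  by move=> y /=; rewrite /bump; case: leqP; lia.
rewrite (count_lt_perm _ (perm_word t)) /=; last exact: ltn_ord.
congr (_ (+) _); congr odd.
elim: (word t) => //= y w ->; congr (_ + _); rewrite count_map.
by apply: eq_count => z /=; rewrite ltnNge leq_bump2 -ltnNge.
Qed.

Lemma avoid132P w : reflect
  (forall i j k, i < j -> j < k -> k < size w ->
     ~~ (nth 0 w i < nth 0 w k < nth 0 w j)) (avoid132 w).
Proof.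
elim: w => [|x w IH] /=; first by apply: ReflectT.
apply: (iffP andP) => [[/(pairwiseP 0) hx /IH hw]|h].
  move=> [|i] [|j] [|k] //= ij jk kw; last exact: hw.
  by apply: hx => //; rewrite inE; lia.
split; first by apply/(pairwiseP 0) => j k _ kw jk; apply: (h 0 j.+1 k.+1).
by apply/IH => i j k ij jk kw; apply: (h i.+1 j.+1 k.+1).
Qed.

Lemma p132E (a : 'I_3) :
  val (p132 a) = if a == 0 :> nat then 0 else if a == 1 :> nat then 2 else 1.
Proof.
rewrite /p132; case: tpermP => [->|->|/eqP a1 /eqP a2];
  [by rewrite /= !inordK | by rewrite /= !inordK | ].
by move: a1 a2; rewrite -!val_eqE /= !inordK //; case: a => [[|[|[|]]]].
Qed.

Lemma avoids_word n (s : 'S_n) : avoids p132 s = avoid132 (word s).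
Proof.
apply/eqP/avoid132P => [e i j k ij jk|h].
  rewrite size_word => kn; apply/negP => h.
  have jn := ltn_trans jk kn; have iN := ltn_trans ij jn.
  move: h; rewrite (nth_word s (Ordinal iN)) (nth_word s (Ordinal jn)).
  rewrite (nth_word s (Ordinal kn)) !ltnS => /andP[h1 h2].
  pose f := [ffun a : 'I_3 => if a == 0 :> nat then Ordinal iN else
                      if a == 1 :> nat then Ordinal jn else Ordinal kn].
  suff : f \in occurrences p132 s by rewrite e inE.
  rewrite inE; apply/andP; split.
    apply/forallP => a; apply/forallP => b; apply/implyP; rewrite !ffunE.
    by case: a b => [[|[|[|//]]] ?] [[|[|[|//]]] ?] //= _; apply: ltn_trans jk.
  apply/forallP => a; apply/forallP => b; apply/eqP.
  case: (ltngtP (s (Ordinal iN)) (s (Ordinal jn))) => [lij||]; [|lia|lia].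
  rewrite !p132E !ffunE.
  by case: a b => [[|[|[|//]]] ?] [[|[|[|//]]] ?] /=; lia.
apply/setP => f; rewrite inE in_set0; apply/negP => /andP[/forallP inc /forallP pat].
have incr (a b : 'I_3) : a < b -> f a < f b.
  by move=> ab; have /forallP/(_ b) := inc a; rewrite ab.
have patt (a b : 'I_3) : (s (f a) < s (f b)) = (p132 a < p132 b).
  by have /forallP/(_ b)/eqP := pat a.
pose o i (lt : i < 3) : 'I_3 := Ordinal lt.
have := h (f (o 0 isT)) (f (o 1 isT)) (f (o 2 isT)).
rewrite size_word !nth_word !ltnS !patt !p132E /= => h3; suff : false by [].
by apply: h3; rewrite ?ltn_ord ?incr.
Qed.

Lemma sorted_ltn_subseq_enum n (t : seq 'I_n) :
  subseq t (enum 'I_n) = sorted (fun i j : 'I_n => i < j) t.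
Proof.
have tr : transitive (fun i j : 'I_n => i < j) by move=> ? ? ?; apply: ltn_trans.
have srt : sorted (fun i j : 'I_n => i < j) (enum 'I_n).
  have := iota_ltn_sorted 0 n; rewrite -val_enum_ord sorted_map.
    by apply: sub_sorted.
apply/idP/idP => [sub|st]; first exact: subseq_sorted srt.
rewrite (_ : t = filter [in t] (enum 'I_n)) ?filter_subseq //.
apply: (irr_sorted_eq tr) => //; first by move=> i; rewrite /= ltnn.
  exact: sorted_filter.
by move=> i; rewrite mem_filter mem_enum andbT.
Qed.

Lemma path_ltn0_succ (w : seq nat) : path ltn 0 (map succn w) = sorted ltn w.
Proof. by case: w => //= x w; rewrite path_map. Qed.

(** Listing the values of an increasing map from ['I_k] to ['I_n] identifies the
occurrences of 12...k with the increasing sequences of [k] positions whose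
letters increase. *)
Lemma card_occurrences_incr n k (s : 'S_n) :
  #|occurrences (incr_pattern k) s| = incr_count k 0 (word s).
Proof.
rewrite incr_countE /word subseqs_map count_map -size_filter.
rewrite cardE -(size_map (fun f : {ffun 'I_k -> 'I_n} => map f (enum 'I_k))).
apply/perm_size/uniq_perm.
- rewrite map_inj_uniq ?enum_uniq // => f g /eq_in_map fg.
  by apply/ffunP => a; apply: fg; rewrite mem_enum.
- by apply/filter_uniq/uniq_subseqs/enum_uniq.
move=> t; rewrite mem_filter mem_subseqs sorted_ltn_subseq_enum /=.
rewrite (map_comp succn) path_ltn0_succ.
have inc2 (T : Type) (f : 'I_k -> T) (r : rel T) : transitive r ->
  sorted r (map f (enum 'I_k)) =
    [forall a : 'I_k, forall b : 'I_k, (a < b) ==> r (f a) (f b)].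
  move=> tr; have trv : transitive (fun i j : 'I_k => i < j).
    by move=> ? ? ?; apply: ltn_trans.
  rewrite sorted_pairwise // pairwise_map; apply/idP/'forall_forallP.
    case: k => [|k'] in f trv *; first by move=> _ [].
    move=> /(pairwiseP ord0) h a b; apply/implyP => ab.
    have := h a b; rewrite !nth_ord_enum; apply => //;
      rewrite inE size_enum_ord; apply: ltn_ord.
  move=> h; have := sorted_ltn_subseq_enum (enum 'I_k); rewrite subseq_refl.
  rewrite sorted_pairwise // => /esym; apply: sub_pairwise => a b /= ab.
  by have := h a b; rewrite ab.
have tr_ord : transitive (fun i j : 'I_n => i < j).
  by move=> ? ? ?; apply: ltn_trans.
apply/mapP/and3P => [[f]|[srt /eqP sz pth]].
  rewrite mem_enum inE => /andP[fi fp] ->; rewrite size_map size_enum_ord eqxx.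
  split=> //; last by rewrite inc2.
  rewrite -map_comp inc2; last exact: ltn_trans.
  apply/'forall_forallP => a b; apply/implyP => ab.
  by move/forallP/(_ a)/forallP/(_ b)/eqP: fp; rewrite !perm1 ab.
pose f := [ffun a => tnth (Tuple (introT eqP sz)) a].
have tE : t = map f (enum 'I_k).
  rewrite -[LHS]/(tval (Tuple (introT eqP sz))) -[LHS]map_tnth_enum.
  by apply: eq_map => a; rewrite ffunE.
exists f; rewrite // mem_enum inE.
move: srt pth; rewrite tE -map_comp !inc2 //; last exact: ltn_trans.
move=> /'forall_forallP srt /'forall_forallP pth; apply/andP; split.
  by apply/'forall_forallP.
apply/'forall_forallP => a b; rewrite !perm1.
have := srt a b; have := srt b a.
by case: (ltngtP a b) => [||/val_inj ->] /=; rewrite ?ltnn //; lia.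
Qed.

(** * The 132-avoiding words *)

(** The inverse of cutting a 132-avoiding word at its largest letter. The left
part is raised above [v], since any letter of it below one of [v] would start
an occurrence of 132 through the largest letter. *)
Definition glue (u v : seq nat) : seq nat :=
  map (addn (size v)) u ++ (size u + size v).+1 :: v.

Definition av132 (n : nat) : seq (seq nat) :=
  [seq w <- permutations (iota 1 n) | avoid132 w].

Lemma mem_av132 n w : (w \in av132 n) = avoid132 w && perm_eq w (iota 1 n).
Proof. by rewrite mem_filter mem_permutations. Qed.

Lemma perm_iota_size n w : perm_eq w (iota 1 n) -> size w = n.
Proof. by move=> /perm_size; rewrite size_iota. Qed.

Lemma perm_iota_bounds n (w : seq nat) (x : nat) :
  perm_eq w (iota 1 n) -> x \in w -> 0 < x <= size w.
Proof.
by move=> h; rewrite (perm_iota_size h) (perm_mem h) mem_iota add1n.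
Qed.

Lemma glue_order i j (u v : seq nat) :
    perm_eq u (iota 1 i) -> perm_eq v (iota 1 j) ->
  let N := (size u + size v).+1 in let u' := map (addn (size v)) u in
  [/\ all (ltn^~ N) u', all (ltn^~ N) v
    & all (fun x => all (ltn^~ x) v) u'].
Proof.
move=> pu pv N u'; split; apply/allP.
- by move=> _ /mapP[x /(perm_iota_bounds pu) xu ->]; rewrite /N /=; lia.
- by move=> y /(perm_iota_bounds pv); rewrite /N /=; lia.
move=> _ /mapP[x /(perm_iota_bounds pu) xu ->].
by apply/allP => y /(perm_iota_bounds pv) /=; lia.
Qed.

Lemma incr_count_glue_perm k i j (u v : seq nat) :
    perm_eq u (iota 1 i) -> perm_eq v (iota 1 j) ->
  incr_count k.+1 0 (glue u v) =
    incr_count k.+1 0 u + incr_count k 0 u + incr_count k.+1 0 v.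
Proof.
move=> pu pv; have [uN vN vu] := glue_order pu pv.
have shift l : incr_count l 0 (map (addn (size v)) u) = incr_count l 0 u.
  rewrite -[RHS](incr_count_shift (size v)) addn0.
  by apply: incr_count_bound; apply/allP => _ /mapP[x xu ->];
    have := perm_iota_bounds pu xu; rewrite /=; lia.
by rewrite incr_count_glue // !shift.
Qed.

Lemma odd_inversions_glue i j (u v : seq nat) :
    perm_eq u (iota 1 i) -> perm_eq v (iota 1 j) ->
  odd (inversions (glue u v)) =
  odd (inversions u) (+) odd (inversions v) (+) odd (j * i.+1).
Proof.
move=> pu pv; have [uN vN vu] := glue_order pu pv.
rewrite inversions_glue // inversions_shift !oddD size_map.
by rewrite (perm_iota_size pu) (perm_iota_size pv).
Qed.

Lemma perm_glue i j (u v : seq nat) :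
    perm_eq u (iota 1 i) -> perm_eq v (iota 1 j) ->
  perm_eq (glue u v) (iota 1 (i + j).+1).
Proof.
move=> pu pv; rewrite /glue (perm_iota_size pu) (perm_iota_size pv).
have -> : iota 1 (i + j).+1 = iota 1 j ++ iota (j + 1) i ++ [:: (i + j).+1].
  have -> : (i + j).+1 = j + (i + 1) by lia.
  by rewrite !iotaD !add1n; congr (_ ++ (iota _ _ ++ [:: _])); lia.
apply/seq.permP => p; rewrite iotaDl !count_cat !count_map /=.
by rewrite (seq.permP pu) (seq.permP pv) addn0 [RHS]addnC addnA.
Qed.

(** Sorting [v] and [u] separately sorts the whole word, so [v] consists of the
smallest letters. *)
Lemma perm_split N (u v : seq nat) : perm_eq (u ++ N.+1 :: v) (iota 1 N.+1) ->
    all (fun x => all (ltn^~ x) v) u ->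
  perm_eq u (iota (size v).+1 (size u)) /\ perm_eq v (iota 1 (size v)).
Proof.
move=> p vu.
have p' : perm_eq (v ++ u) (iota 1 N).
  apply/seq.permP => q; move/seq.permP/(_ q): p.
  rewrite -[in iota _ _](addn1 N) iotaD add1n !count_cat /= addn0.
  by rewrite addnCA addnC => /eqP; rewrite eqn_add2r addnC => /eqP.
(* Both sides are the sorted rearrangement of the same letters. *)
have sv : sort leq v ++ sort leq u = iota 1 N.
  apply: (sorted_eq leq_trans anti_leq); last 2 first.
  - exact: iota_sorted.
  - by apply: perm_trans p'; apply: perm_cat; rewrite perm_sort.
  rewrite sorted_pairwise; last exact: leq_trans.
  rewrite pairwise_cat -!sorted_pairwise; try exact: leq_trans.
  rewrite !(sort_sorted leq_total) !andbT; apply/allrelP => y x.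
  by rewrite !mem_sort => yv /(allP vu)/allP/(_ y yv)/ltnW.
have sz : N = size v + size u.
  by rewrite -size_cat (perm_size p') size_iota.
move/eqP: sv; rewrite sz iotaD eqseq_cat ?size_sort ?size_iota // add1n.
by move=> /andP[/eqP <- /eqP <-]; rewrite !(perm_sym _ (sort _ _)) !perm_sort.
Qed.

(** The decomposition of a 132-avoiding word at its largest letter. *)
Lemma mem_av132_glue n w : reflect
  (exists i u v, [/\ i <= n, u \in av132 i, v \in av132 (n - i) & w = glue u v])
  (w \in av132 n.+1).
Proof.
apply: (iffP idP) => [|[i [u [v [le_in]]]]]; last first.
  rewrite !mem_av132 => /andP[au pu] /andP[av pv] ->.
  have := perm_glue pu pv; rewrite subnKC // => ->; rewrite andbT.
  have [uN vN vu] := glue_order pu pv.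
  by rewrite avoid132_glue // avoid132_shift au.
rewrite mem_av132 => /andP[aw pw].
have wn : n.+1 \in w by rewrite (perm_mem pw) mem_iota; lia.
case/splitPr: wn => u' v in aw pw *.
have vu : all (fun x => all (ltn^~ x) v) u'.
  apply: avoid132_split aw; first by rewrite (perm_uniq pw) iota_uniq.
  by rewrite (perm_all _ pw); apply/allP => x; rewrite mem_iota /=; lia.
have [pu' pv] := perm_split pw vu.
have sz : (n = size u' + size v)%N.
  by have := perm_size pw; rewrite size_cat size_iota /=; lia.
(* Truncated subtraction is exact here: the letters of u' exceed size v. *)
pose u := map (subn^~ (size v)) u'.
have u'E : u' = map (addn (size v)) u.
  rewrite -map_comp -[LHS]map_id; apply/eq_in_map => x /=.
  by rewrite (perm_mem pu') mem_iota; lia.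
have pu : perm_eq u (iota 1 (size u')).
  apply: (perm_map_inj (@addnI (size v))); rewrite -u'E -iotaDl.
  by rewrite addn1.
exists (size u'), u, v; rewrite !mem_av132.
have /andP[au /= /andP[_ av]] := avoid132_cat aw.
split; first by rewrite sz leq_addr.
- by rewrite -(avoid132_shift (size v)) -u'E au pu.
- by rewrite av sz addKn.
by rewrite /glue -u'E sz (perm_iota_size pu).
Qed.

(** The position of the largest letter recovers the size of the left factor, so
that different splittings of [n] produce different words. *)
Lemma index_max_glue i j (u v : seq nat) :
    perm_eq u (iota 1 i) -> perm_eq v (iota 1 j) ->
  index (size (glue u v)) (glue u v) = i.
Proof.
move=> pu pv; have [uN _ _] := glue_order pu pv.
rewrite -(perm_iota_size pu) size_cat size_map /= addnS index_cat size_map.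
by rewrite /= eqxx addn0; case: ifP => // /(allP uN); rewrite /= ltnn.
Qed.

Lemma glue_inj (u v u' v' : seq nat) : size u = size u' ->
  glue u v = glue u' v' -> (u, v) = (u', v').
Proof.
move=> szu /eqP; rewrite /glue eqseq_cat ?size_map // eqseq_cons.
move=> /and3P[/eqP eu _ /eqP ev]; move: eu; rewrite ev.
by move=> /(inj_map (@addnI _)) ->.
Qed.

Lemma uniq_flatten_map (S T : eqType) (key : T -> S) (f : S -> seq T) s :
    uniq s -> (forall i, uniq (f i)) -> (forall i x, x \in f i -> key x = i) ->
  uniq (flatten (map f s)).
Proof.
move=> us uf fk; elim: s us => //= i s IH /andP[si us].
rewrite cat_uniq uf IH // andbT /=; apply/hasPn => x /flatten_mapP[j js xj].
apply: contraNN si => /= xi; by rewrite -(fk _ _ xi) (fk _ _ xj).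
Qed.

Lemma perm_av132_rec n : perm_eq (av132 n.+1)
  (flatten [seq [seq glue u v | u <- av132 i, v <- av132 (n - i)]
           | i <- iota 0 n.+1]).
Proof.
have uniq_av k : uniq (av132 k) by rewrite filter_uniq // permutations_uniq.
apply: uniq_perm => //.
  apply: (uniq_flatten_map (key := fun w => index (size w) w)) => [|i|i w].
  - exact: iota_uniq.
  - apply: allpairs_uniq => // x y /allpairsP[[u v] /= [hu hv ->]].
    move=> /allpairsP[[u' v'] /= [hu' hv' ->]]; apply: glue_inj.
    move: hu hu'; rewrite !mem_av132 => /andP[_ /perm_iota_size ->].
    by move=> /andP[_ /perm_iota_size ->].
  move=> /allpairsP[[u v] /= [+ + ->]]; rewrite !mem_av132.
  by move=> /andP[_ pu] /andP[_ pv]; apply: index_max_glue pu pv.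
move=> w; apply/mem_av132_glue/flatten_mapP.
  move=> [i [u [v [le_in hu hv ->]]]]; exists i; first by rewrite mem_iota ltnS.
  by apply/allpairsP; exists (u, v).
move=> [i + /allpairsP[[u v] /= [hu hv ->]]].
by rewrite mem_iota ltnS => le_in; exists i, u, v.
Qed.

(** * Signed counts *)

Local Open Scope ring_scope.

Lemma big_av132_rec (R : nmodType) n (F : seq nat -> R) :
  \sum_(w <- av132 n.+1) F w =
  \sum_(i < n.+1) \sum_(u <- av132 i) \sum_(v <- av132 (n - i)) F (glue u v).
Proof.
rewrite (perm_big _ (perm_av132_rec n)) big_flatten big_map.
rewrite -[iota 0 _]/(index_iota 0 n.+1) big_mkord.
by apply: eq_bigr => i _; rewrite big_allpairs_dep.
Qed.

Definition signed_count (k r n : nat) : rat :=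
  \sum_(w <- av132 n) (incr_count k 0 w == r)%:R * (-1) ^+ inversions w.

Lemma sign_glue i j (u v : seq nat) :
    perm_eq u (iota 1 i) -> perm_eq v (iota 1 j) ->
  (-1) ^+ inversions (glue u v) =
  (-1) ^+ (j * i.+1) * ((-1) ^+ inversions u * (-1) ^+ inversions v) :> rat.
Proof.
move=> pu pv; rewrite -signr_odd (odd_inversions_glue pu pv).
by rewrite !signr_addb !signr_odd mulrC.
Qed.

(** [glue u v] avoids 12...(k+2) when [u] avoids 12...(k+1) and [v] avoids
12...(k+2): the condition on [u] for 12...(k+2) is then automatic by
[incr_count_pred]. *)
Lemma signed_count_avoid_rec k n :
  signed_count k.+2 0 n.+1 =
  \sum_(i < n.+1) (-1) ^+ ((n - i) * i.+1) *
     (signed_count k.+1 0 i * signed_count k.+2 0 (n - i)).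
Proof.
rewrite /signed_count big_av132_rec; apply: eq_bigr => i _.
rewrite big_distrlr mulr_sumr; apply: eq_big_seq => u.
rewrite mem_av132 => /andP[_ pu]; rewrite mulr_sumr; apply: eq_big_seq => v.
rewrite mem_av132 => /andP[_ pv]; rewrite (sign_glue pu pv).
rewrite (incr_count_glue_perm k.+1 pu pv) !addn_eq0.
have := @incr_count_pred k.+1 0 u.
case: (incr_count k.+1 0 u) => [|a] h; last by rewrite andbF /= !(mul0r, mulr0).
by have -> : incr_count k.+2 0 u = 0%N; [lia | rewrite /= !mul1r; ring].
Qed.

(** The single occurrence of 12...(k+2) in [glue u v] either ends in the new
largest letter, and comes from a single occurrence of 12...(k+1) in [u], or
lies in [v]. It cannot lie in [u], since it would contain several occurrences
of 12...(k+1), all of which the largest letter completes. *)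
Lemma signed_count_once_rec k n :
  signed_count k.+2 1 n.+1 =
  \sum_(i < n.+1) (-1) ^+ ((n - i) * i.+1) *
     (signed_count k.+1 1 i * signed_count k.+2 0 (n - i)
      + signed_count k.+1 0 i * signed_count k.+2 1 (n - i)).
Proof.
rewrite /signed_count big_av132_rec; apply: eq_bigr => i _.
rewrite !big_distrlr -big_split mulr_sumr; apply: eq_big_seq => u.
rewrite mem_av132 => /andP[_ pu] /=; rewrite -big_split mulr_sumr /=.
apply: eq_big_seq => v.
rewrite mem_av132 => /andP[_ pv]; rewrite (sign_glue pu pv).
rewrite (incr_count_glue_perm k.+1 pu pv).
have := @incr_count_pred k.+1 0 u.
case: (incr_count k.+1 0 u) => [|[|a]] h.
- have -> : incr_count k.+2 0 u = 0%N by lia.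
  by rewrite /= add0n; ring.
- have -> : incr_count k.+2 0 u = 0%N by lia.
  by rewrite /= add0n add1n eqSS; ring.
by rewrite addnS addSn eqSS addnS addSn /=; ring.
Qed.

Lemma av132_0 : av132 0 = [:: [::]].
Proof. by []. Qed.

Lemma signed_count_avoid0 k : signed_count k.+1 0 0 = 1.
Proof. by rewrite /signed_count av132_0 big_seq1 /= mul1r. Qed.

Lemma signed_count_once0 k : signed_count k.+1 1 0 = 0.
Proof. by rewrite /signed_count av132_0 big_seq1 /= mul0r. Qed.

Lemma incr_count1_av132 n w : w \in av132 n -> incr_count 1 0 w = n.
Proof.
rewrite mem_av132 => /andP[_ p]; rewrite incr_count1 ?(perm_iota_size p) //.
by apply/allP => x; rewrite (perm_mem p) mem_iota => /andP[].
Qed.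

Lemma signed_count1_avoid n : signed_count 1 0 n = (n == 0)%:R.
Proof.
case: n => [|n]; first exact: signed_count_avoid0.
by rewrite /signed_count big_seq big1 // => w /incr_count1_av132 ->; rewrite mul0r.
Qed.

Lemma signed_count1_once n : signed_count 1 1 n = (n == 1)%:R.
Proof.
case: n => [|[|n]]; first exact: signed_count_once0.
  rewrite /signed_count big_av132_rec big_ord1 /= av132_0 !big_seq1.
  by rewrite /= mul1r.
by rewrite /signed_count big_seq big1 // => w /incr_count1_av132 ->; rewrite mul0r.
Qed.

Lemma Mgf_signed_count k r n : Mgf (incr_pattern k) r n = signed_count k r n.
Proof.
rewrite /Mgf /even_count /odd_count /signed_count /av132 big_filter.
rewrite -(perm_big _ (words_enum n)) big_map big_enum_cond /=.
rewrite -!sum1_card !natr_sum big_mkcond [X in _ - X]big_mkcond -sumrB.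
rewrite [RHS]big_mkcond; apply: eq_bigr => s _ /=.
rewrite !inE /= avoids_word /contains_exactly card_occurrences_incr.
rewrite -signr_odd odd_inversions_word.
case: (avoid132 (word s)) => /=; last by rewrite subrr.
case: (incr_count k 0 (word s) == r) => /=; last by rewrite subrr mul0r.
by case: (odd_perm s); rewrite /= mul1r ?subr0 ?sub0r.
Qed.

(** * The ring of formal power series *)

(** A synonym of [series] which carries the ring structure of formal power
series; equality and choice come from the classical axioms. *)
Definition fps := series.

HB.instance Definition _ := gen_eqMixin fps.
HB.instance Definition _ := gen_choiceMixin fps.

Section FpsRing.
Implicit Types f g h : fps.

Definition fps_zero : fps := fun=> 0.
Definition fps_opp f : fps := fun n => - f n.
Definition fps_add f g : fps := fun n => f n + g n.
Definition fps_one : fps := series_of_poly 1.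
Definition fps_mul f g : fps := series_mul f g.

Fact fps_addA : associative fps_add.
Proof. by move=> f g h; apply/funext => n; apply: addrA. Qed.
Fact fps_addC : commutative fps_add.
Proof. by move=> f g; apply/funext => n; apply: addrC. Qed.
Fact fps_add0 : left_id fps_zero fps_add.
Proof. by move=> f; apply/funext => n; apply: add0r. Qed.
Fact fps_addN : left_inverse fps_zero fps_opp fps_add.
Proof. by move=> f; apply/funext => n; apply: addNr. Qed.

HB.instance Definition _ :=
  GRing.isZmodule.Build fps fps_addA fps_addC fps_add0 fps_addN.

Definition trunc_poly f N : {poly rat} := \poly_(i < N) f i.

(** Coefficients up to [n] only involve truncations, which reduces the ring
axioms to those of polynomials. *)
Lemma series_mul_trunc f g N n : (n < N)%N ->
  series_mul f g n = (trunc_poly f N * trunc_poly g N)`_n.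
Proof.
move=> nN; rewrite coefM; apply: eq_bigr => i _; rewrite !coef_poly.
by rewrite (leq_ltn_trans _ nN) ?(leq_ltn_trans _ nN) ?leq_subr // -ltnS.
Qed.

Lemma series_mulM_trunc f g h n :
  series_mul f (series_mul g h) n
    = (trunc_poly f n.+1 * (trunc_poly g n.+1 * trunc_poly h n.+1))`_n.
Proof.
rewrite coefM; apply: eq_bigr => i _; rewrite coef_poly ltn_ord.
by congr (_ * _); apply: series_mul_trunc; rewrite ltnS leq_subr.
Qed.

Fact fps_mulC : commutative fps_mul.
Proof.
move=> f g; apply/funext => n.
by rewrite /fps_mul !(series_mul_trunc _ _ (ltnSn n)) mulrC.
Qed.

Fact fps_mulA : associative fps_mul.
Proof.
move=> f g h; apply/funext => n; rewrite [RHS](congr1 (@^~ n) (fps_mulC _ _)).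
by rewrite /fps_mul !series_mulM_trunc mulrA mulrC.
Qed.

Fact fps_mul1 : left_id fps_one fps_mul.
Proof.
move=> f; apply/funext => n; rewrite /fps_mul /series_mul big_ord_recl big1.
  by rewrite /fps_one /series_of_poly coef1 mul1r addr0 subn0.
by move=> i _; rewrite /fps_one /series_of_poly coef1 mul0r.
Qed.

Fact fps_mulDl : left_distributive fps_mul fps_add.
Proof.
move=> f g h; apply/funext => n; rewrite /fps_mul /fps_add /series_mul -big_split.
by apply: eq_bigr => i _; rewrite mulrDl.
Qed.

Fact fps_one_neq0 : fps_one != 0.
Proof.
apply/eqP => /(congr1 (@^~ 0%N)); rewrite /fps_one /series_of_poly coef1 => /eqP.
by rewrite oner_eq0.
Qed.

HB.instance Definition _ := GRing.Zmodule_isComNzRing.Build fps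
  fps_mulA fps_mulC fps_mul1 fps_mulDl fps_one_neq0.

Lemma fpsDE f g n : (f + g) n = f n + g n. Proof. by []. Qed.
Lemma fpsME f g n : (f * g) n = \sum_(i < n.+1) f i * g (n - i)%N.
Proof. by []. Qed.

Definition fps_of_poly (p : {poly rat}) : fps := series_of_poly p.

Fact fps_of_poly_is_additive : zmod_morphism fps_of_poly.
Proof. by move=> p q; apply/funext => n; apply: coefB. Qed.
Fact fps_of_poly_is_multiplicative : monoid_morphism fps_of_poly.
Proof. by split=> // p q; apply/funext => n; apply: coefM. Qed.

HB.instance Definition _ :=
  GRing.isZmodMorphism.Build {poly rat} fps fps_of_poly
    fps_of_poly_is_additive.
HB.instance Definition _ :=
  GRing.isMonoidMorphism.Build {poly rat} fps fps_of_poly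
    fps_of_poly_is_multiplicative.

Definition fpsX : fps := fps_of_poly 'X.

Lemma fpsXM0 f : (fpsX * f) 0%N = 0.
Proof. by rewrite fpsME big_ord1 /fpsX /fps_of_poly /series_of_poly coefX mul0r. Qed.

Lemma fpsXMS f n : (fpsX * f) n.+1 = f n.
Proof.
rewrite fpsME 2!big_ord_recl big1 /=.
  rewrite /fpsX /fps_of_poly /series_of_poly !coefX /=.
  by rewrite mul0r mul1r add0r addr0 subSS subn0.
by move=> i _; rewrite /fpsX /fps_of_poly /series_of_poly coefX /= mul0r.
Qed.

(** If [f * g = 0], the coefficients of [g] vanish one after the other. *)
Lemma fps_lreg f : f 0%N = 1 -> GRing.lreg f.
Proof.
move=> f0; apply: mulrI0_lreg => g fg; apply/funext => n.
elim/ltn_ind: n => n IH; have /(congr1 (@^~ n)) := fg.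
rewrite fpsME big_ord_recl f0 mul1r subn0 big1 ?addr0 //.
move=> i _; rewrite IH ?mulr0 //= /bump /= add1n ltn_subrL.
by case: n i {IH} => // -[].
Qed.

End FpsRing.

(** * Solving the recurrences *)

(** Complex numbers over [K] are represented by their real and imaginary parts.
In this section [a k] and [b k] are the real and imaginary parts of z_(k+1),
and [c k], [d k] those of w_(k+1), where z and w are the complex series of the
introduction; the hypotheses [aS], [bS], [cS], [dS] are their recurrences.
[D k] is the squared modulus of 1 - i x conj(z_(k+1)), and [W m] that of
V_(m+1) - i x V_m, the denominator of z_(2m+2). *)
Section Recurrence.
Variables (K : comNzRingType) (x : K) (V a b c d : nat -> K).

Let D k := (1 - x * b k) ^+ 2 + (x * a k) ^+ 2.
Let W m := V m.+1 ^+ 2 + (x * V m) ^+ 2.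

Hypotheses (V0 : V 0 = 1) (V1 : V 1 = 1).
Hypothesis VS : forall m, V m.+2 = V m.+1 - x ^+ 2 * V m.
Hypotheses (a0 : a 0 = 1) (b0 : b 0 = 0) (c0 : c 0 = 0) (d0 : d 0 = x).
Hypothesis aS : forall k, a k.+1 = 1 + x * (b k * a k.+1 - a k * b k.+1).
Hypothesis bS : forall k, b k.+1 = x * (a k * a k.+1 + b k * b k.+1).
Hypothesis cS : forall k, c k.+1 =
  x * (d k * a k.+1 - c k * b k.+1) + x * (b k * c k.+1 - a k * d k.+1).
Hypothesis dS : forall k, d k.+1 =
  x * (c k * a k.+1 + d k * b k.+1) + x * (a k * c k.+1 + b k * d k.+1).
Hypothesis Dreg : forall k, GRing.lreg (D k).
Hypothesis Vreg : forall m, GRing.lreg (V m).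
Hypothesis Wreg : forall m, GRing.lreg (W m).

Let a_eq k : a k.+1 - x * (b k * a k.+1 - a k * b k.+1) = 1.
Proof. by rewrite {1}aS addrK. Qed.

Let b_eq k : b k.+1 - x * (a k * a k.+1 + b k * b k.+1) = 0.
Proof. by rewrite {1}bS subrr. Qed.

Let c_eq k : c k.+1 - x * (b k * c k.+1 - a k * d k.+1)
  = x * (d k * a k.+1 - c k * b k.+1).
Proof. by rewrite {1}cS addrK. Qed.

Let d_eq k : d k.+1 - x * (a k * c k.+1 + b k * d k.+1)
  = x * (c k * a k.+1 + d k * b k.+1).
Proof. by rewrite {1}dS addrK. Qed.

Let D_a k : D k * a k.+1 = 1 - x * b k.
Proof.
transitivity ((1 - x * b k) * (a k.+1 - x * (b k * a k.+1 - a k * b k.+1))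
              - x * a k * (b k.+1 - x * (a k * a k.+1 + b k * b k.+1))).
  by rewrite /D; ring.
by rewrite a_eq b_eq; ring.
Qed.

Let D_b k : D k * b k.+1 = x * a k.
Proof.
transitivity ((1 - x * b k) * (b k.+1 - x * (a k * a k.+1 + b k * b k.+1))
              + x * a k * (a k.+1 - x * (b k * a k.+1 - a k * b k.+1))).
  by rewrite /D; ring.
by rewrite a_eq b_eq; ring.
Qed.

(** z_(k+2) is the inverse of a number of squared modulus [D k]. *)
Let D_norm k : D k * (a k.+1 ^+ 2 + b k.+1 ^+ 2) = 1.
Proof.
apply: (@Dreg k); transitivity ((D k * a k.+1) ^+ 2 + (D k * b k.+1) ^+ 2).
  by ring.
by rewrite D_a D_b mulr1.
Qed.

Let D_cd k : D k * (a k.+1 * c k.+1 + b k.+1 * d k.+1)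
  = x * (d k * a k.+1 - c k * b k.+1).
Proof.
by rewrite -c_eq mulrDr !mulrA D_a D_b; ring.
Qed.

Let D_dc k : D k * (a k.+1 * d k.+1 - b k.+1 * c k.+1)
  = x * (c k * a k.+1 + d k * b k.+1).
Proof.
by rewrite -d_eq mulrBr !mulrA D_a D_b; ring.
Qed.

(** The real part of w_(k+2) = i x conj(w_(k+1)) z_(k+2)^2. The recurrence
expresses conj(z_(k+2)) w_(k+2) up to the factor [D k]; it is then multiplied
by z_(k+2), using [D_norm]. *)
Lemma once_even k : c k.+1 =
  x * (d k * (a k.+1 ^+ 2 - b k.+1 ^+ 2) - 2%:R * (a k.+1 * b k.+1) * c k).
Proof.
transitivity (D k * (a k.+1 ^+ 2 + b k.+1 ^+ 2) * c k.+1).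
  by rewrite D_norm mul1r.
transitivity (a k.+1 * (D k * (a k.+1 * c k.+1 + b k.+1 * d k.+1))
            - b k.+1 * (D k * (a k.+1 * d k.+1 - b k.+1 * c k.+1))); first by ring.
by rewrite D_cd D_dc; ring.
Qed.

Lemma once_odd k : d k.+1 =
  x * (c k * (a k.+1 ^+ 2 - b k.+1 ^+ 2) + 2%:R * (a k.+1 * b k.+1) * d k).
Proof.
transitivity (D k * (a k.+1 ^+ 2 + b k.+1 ^+ 2) * d k.+1).
  by rewrite D_norm mul1r.
transitivity (b k.+1 * (D k * (a k.+1 * c k.+1 + b k.+1 * d k.+1))
            + a k.+1 * (D k * (a k.+1 * d k.+1 - b k.+1 * c k.+1))); first by ring.
by rewrite D_cd D_dc; ring.
Qed.

(** With R_m = V_(m-1) / V_m: z = 1 + i x R_m and w = i x^(2m+1) / V_m^2, the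
imaginary part of z being written through V_(m+1) = V_m - x^2 V_(m-1) to avoid
the index m - 1. *)
Definition odd_shape m k :=
  [/\ a k = 1, V m * (1 - x * b k) = V m.+1,
      c k = 0 & V m ^+ 2 * d k = x ^+ (2 * m + 1)].

(** z = V_m / (V_(m+1) - i x V_m) and
w = x^(2m+2) ((V_(m+1) + i x V_m) / W_m)^2. *)
Definition even_shape m k :=
  [/\ V m.+1 * a k = V m * (1 - x * b k),
      V m.+1 * b k = V m * (x * a k),
      W m ^+ 2 * c k = x ^+ (2 * m + 2) * (V m.+1 ^+ 2 - (x * V m) ^+ 2)
    & W m ^+ 2 * d k = x ^+ (2 * m + 2) * (2%:R * x * V m * V m.+1)].

(** The equations for z follow from its recurrence multiplied by V_m. They
determine [W m * a] and [W m * b], which are then inserted in the formula for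
w. *)
Lemma odd_to_even m k : odd_shape m k -> even_shape m k.+1.
Proof.
move=> [ak bk ck dk].
have e1 : V m.+1 * a k.+1 = V m * (1 - x * b k.+1).
  transitivity (V m * (a k.+1 - x * (b k * a k.+1 - a k * b k.+1))
                - x * V m * b k.+1); first by rewrite -bk ak; ring.
  by rewrite a_eq; ring.
have e2 : V m.+1 * b k.+1 = V m * (x * a k.+1).
  transitivity (V m * (b k.+1 - x * (a k * a k.+1 + b k * b k.+1))
                + x * V m * a k.+1); first by rewrite -bk ak; ring.
  by rewrite b_eq; ring.
have Wa : W m * a k.+1 = V m * V m.+1.
  transitivity (V m.+1 * (V m.+1 * a k.+1) + x * V m * (V m * (x * a k.+1))).
    by rewrite /W; ring.
  by rewrite e1 -e2; ring.
have Wb : W m * b k.+1 = x * V m ^+ 2.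
  transitivity (V m.+1 * (V m.+1 * b k.+1) + x * V m * (V m * (x * b k.+1))).
    by rewrite /W; ring.
  have -> : V m * (x * b k.+1) = V m - V m.+1 * a k.+1 by rewrite e1; ring.
  by rewrite e2; ring.
split=> //.
  transitivity (x * d k * ((W m * a k.+1) ^+ 2 - (W m * b k.+1) ^+ 2)).
    by rewrite once_even ck; ring.
  transitivity (x * (V m ^+ 2 * d k) * (V m.+1 ^+ 2 - (x * V m) ^+ 2)).
    by rewrite Wa Wb; ring.
  by rewrite dk (addnS _ 1) -exprS.
transitivity (x * d k * (2%:R * (W m * a k.+1) * (W m * b k.+1))).
  by rewrite once_odd ck; ring.
transitivity (x * (V m ^+ 2 * d k) * (2%:R * x * V m * V m.+1)).
  by rewrite Wa Wb; ring.
by rewrite dk (addnS _ 1) -exprS.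
Qed.

(** The equations for z_(2m+2) imply that it lies on the circle b = x |z|^2,
which 1 / (1 - i x conj z) maps to the line of real part 1. Also
conj(z_(2m+2)) z_(2m+3) is the real number R_(m+1), so that w returns to the
imaginary axis. *)
Lemma even_to_odd m k : even_shape m k -> odd_shape m.+1 k.+1.
Proof.
move=> [e1 e2 ck dk].
have bk : b k = x * (a k ^+ 2 + b k ^+ 2).
  apply: (@Vreg m.+1); rewrite e2.
  transitivity (x * (V m.+1 * a k) * a k + x * (V m.+1 * b k) * b k); last by ring.
  by rewrite e1 e2; ring.
have Dk : D k = 1 - x * b k.
  transitivity (1 - x * b k - x * (b k - x * (a k ^+ 2 + b k ^+ 2))).
    by rewrite /D; ring.
  by rewrite -bk subrr mulr0 subr0.
have ak1 : a k.+1 = 1 by apply: (@Dreg k); rewrite D_a mulr1.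
have bk1 : V m.+1 * b k.+1 = x * V m.
  apply: (@Dreg k); transitivity (V m.+1 * (D k * b k.+1)); first by ring.
  transitivity (x * (V m.+1 * a k)); first by rewrite D_b; ring.
  by rewrite e1 Dk; ring.
(* The factors that clear the denominators of [b k.+1] and of [c k], [d k]. *)
have VWreg : GRing.lreg (V m.+1 ^+ 2 * W m ^+ 2).
  by apply: lregM; apply: lregX.
split=> //.
- transitivity (V m.+1 - x * (V m.+1 * b k.+1)); first by ring.
  by rewrite bk1 VS; ring.
- apply: VWreg; rewrite mulr0.
  transitivity (x * ((W m ^+ 2 * d k) * (V m.+1 ^+ 2 - (V m.+1 * b k.+1) ^+ 2)
      - 2%:R * V m.+1 * (V m.+1 * b k.+1) * (W m ^+ 2 * c k))).
    by rewrite once_even ak1; ring.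
  by rewrite bk1 ck dk; ring.
have Wreg2 : GRing.lreg (W m ^+ 2) by apply: lregX.
apply: Wreg2.
transitivity (x * ((W m ^+ 2 * c k) * (V m.+1 ^+ 2 - (V m.+1 * b k.+1) ^+ 2)
    + 2%:R * V m.+1 * (V m.+1 * b k.+1) * (W m ^+ 2 * d k))).
  by rewrite once_odd ak1; ring.
rewrite bk1 ck dk (_ : 2 * m.+1 + 1 = (2 * m + 2).+1)%N; last first.
  by rewrite mulnS addn1 addnC.
by rewrite [in RHS](exprS x (2 * m + 2)) /W; ring.
Qed.

Lemma shapes m : odd_shape m (2 * m) /\ even_shape m (2 * m).+1.
Proof.
suff od : odd_shape m (2 * m) by split=> //; apply: odd_to_even.
elim: m => [|m IH].
  by split; rewrite ?a0 ?c0 // ?V0 ?V1 ?b0 ?d0; ring.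
by rewrite mulnS; apply/even_to_odd/odd_to_even.
Qed.

End Recurrence.

(** * Even and odd parts of the signed generating functions *)

Definition even_part (f : fps) : fps := fun n => if odd n then 0 else f n.
Definition odd_part (f : fps) : fps := fun n => if odd n then f n else 0.

Lemma even_odd_part f : even_part f + odd_part f = f.
Proof.
apply/funext => n; rewrite fpsDE /even_part /odd_part.
by case: odd; rewrite ?add0r ?addr0.
Qed.

(** The product with the sign of the decomposition at the largest letter. With
f = f_0 + f_1 split into even and odd parts, and i^2 = -1, it sends f_0 + i f_1
and g_0 + i g_1 to (f_0 - i f_1) (g_0 + i g_1), up to the factor i that the
shift by [fpsX] contributes. *)
Definition twist (f g : fps) : fps :=
  fun n => \sum_(i < n.+1) (-1) ^+ ((n - i) * i.+1) * (f i * g (n - i)%N).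

Lemma even_partX (f : fps) : even_part (fpsX * f) = fpsX * odd_part f.
Proof.
apply/funext => -[|n]; first by rewrite fpsXM0 /even_part /= fpsXM0.
by rewrite fpsXMS /even_part fpsXMS /odd_part /=; case: odd.
Qed.

Lemma odd_partX (f : fps) : odd_part (fpsX * f) = fpsX * even_part f.
Proof.
apply/funext => -[|n]; first by rewrite fpsXM0 /odd_part.
by rewrite fpsXMS /odd_part fpsXMS /even_part /=; case: odd.
Qed.

Lemma even_partD f g : even_part (f + g) = even_part f + even_part g.
Proof.
by apply/funext => n; rewrite fpsDE /even_part fpsDE; case: odd; rewrite ?addr0.
Qed.

Lemma odd_partD f g : odd_part (f + g) = odd_part f + odd_part g.
Proof.
by apply/funext => n; rewrite fpsDE /odd_part fpsDE; case: odd; rewrite ?addr0.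
Qed.

Lemma even_part1 : even_part 1 = 1.
Proof.
apply/funext => n; rewrite /even_part /GRing.one /= /fps_one /series_of_poly coef1.
by case: n => // n; case: odd.
Qed.

Lemma odd_part1 : odd_part 1 = 0.
Proof.
apply/funext => n; rewrite /odd_part /GRing.one /= /fps_one /series_of_poly coef1.
by case: n => // n; case: odd.
Qed.

Lemma twist_odd_part f g : odd_part (twist f g) =
  odd_part f * even_part g - even_part f * odd_part g.
Proof.
apply/funext => n; rewrite /odd_part /twist.
rewrite -[RHS]/(series_mul _ _ n - series_mul _ _ n) /series_mul -sumrB.
case on : (odd n); last first.
  rewrite big1 // => i _; rewrite /even_part /odd_part oddB ?leq_ord // on /=.
  by case: odd; rewrite ?mul0r ?mulr0 subr0.
apply: eq_bigr => i _; rewrite /even_part /odd_part -signr_odd oddM oddB ?leq_ord //.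
rewrite on /=.
by case: (odd i); rewrite /= ?mul0r ?mulr0 ?subr0 ?sub0r ?mul1r ?mulN1r.
Qed.

Lemma twist_even_part f g : even_part (twist f g) =
  even_part f * even_part g + odd_part f * odd_part g.
Proof.
apply/funext => n; rewrite /even_part /twist.
rewrite -[RHS]/(series_mul _ _ n + series_mul _ _ n) /series_mul -big_split.
case on : (odd n).
  rewrite big1 // => i _; rewrite /even_part /odd_part /= oddB ?leq_ord // on /=.
  by case: odd; rewrite ?mul0r ?mulr0 addr0.
apply: eq_bigr => i _; rewrite /even_part /odd_part -signr_odd oddM /= oddB ?leq_ord //.
rewrite on /=.
by case: (odd i); rewrite /= ?mul0r ?mulr0 ?addr0 ?add0r ?mul1r ?mulN1r.
Qed.

Definition avoid_series (k : nat) : fps := signed_count k 0.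
Definition once_series (k : nat) : fps := signed_count k 1.

Lemma avoid_series1 : avoid_series 1 = 1.
Proof.
apply/funext => n; rewrite /avoid_series signed_count1_avoid.
by rewrite /GRing.one /= /fps_one /series_of_poly coef1.
Qed.

Lemma once_series1 : once_series 1 = fpsX.
Proof.
apply/funext => n; rewrite /once_series signed_count1_once.
by rewrite /fpsX /fps_of_poly /series_of_poly coefX.
Qed.

Lemma avoid_seriesS k :
  avoid_series k.+2 = 1 + fpsX * twist (avoid_series k.+1) (avoid_series k.+2).
Proof.
apply/funext => -[|n]; rewrite fpsDE ?fpsXM0 ?fpsXMS.
  rewrite /avoid_series signed_count_avoid0.
  by rewrite /GRing.one /= /fps_one /series_of_poly coef1 addr0.
rewrite /avoid_series signed_count_avoid_rec.
by rewrite /GRing.one /= /fps_one /series_of_poly coef1 add0r.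
Qed.

Lemma once_seriesS k : once_series k.+2 =
  fpsX * twist (once_series k.+1) (avoid_series k.+2)
  + fpsX * twist (avoid_series k.+1) (once_series k.+2).
Proof.
apply/funext => -[|n]; rewrite fpsDE ?fpsXM0 ?fpsXMS.
  by rewrite /once_series signed_count_once0 addr0.
rewrite /once_series signed_count_once_rec /twist -big_split /=.
by apply: eq_bigr => i _; rewrite mulrDr.
Qed.

(** * Chebyshev polynomials *)

(** x^m U_m(1/(2x)), see [chebU_chebV]. *)
Fixpoint chebV (m : nat) : {poly rat} :=
  match m with
  | 0 => 1
  | 1 => 1
  | (m'.+1 as m1).+1 => chebV m1 - 'X ^+ 2 * chebV m'
  end.

Lemma chebVS m : chebV m.+2 = chebV m.+1 - 'X ^+ 2 * chebV m.
Proof. by []. Qed.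

Lemma chebV_coef0 m : (chebV m)`_0 = 1.
Proof.
suff : (chebV m)`_0 = 1 /\ (chebV m.+1)`_0 = 1 by case.
elim: m => [|m [IH1 IH2]]; first by rewrite coef1.
by rewrite chebVS coefB coefXnM IH2 /= subr0.
Qed.

(** The squared modulus of V_(m+1) - i x V_m, which is also
V_(m+1)^2 (1 + x^2 R_(m+1)(x^2)^2). *)
Definition chebW m := chebV m.+1 ^+ 2 + ('X * chebV m) ^+ 2.

Lemma chebW_coef0 m : (chebW m)`_0 = 1.
Proof.
have := chebV_coef0 m.+1; rewrite /chebW; move: (chebV m.+1) => p p0.
by rewrite coefD exprMn coefXnM /= addr0 expr2 coefM big_ord1 /= p0 mulr1.
Qed.

Lemma fps_of_poly_lreg (p : {poly rat}) : p`_0 = 1 -> GRing.lreg (fps_of_poly p).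
Proof. exact: fps_lreg. Qed.

Lemma fps_mul0 (f g : fps) : (f * g) 0%N = f 0%N * g 0%N.
Proof. by rewrite fpsME big_ord1. Qed.

(** Instantiates [shapes] with the even and odd parts of the two families of
series; adding the two parts of w gives the generating function. *)
Lemma once_series_rational m :
  fps_of_poly (chebV m ^+ 2) * once_series (2 * m + 1) = fps_of_poly 'X^(2 * m + 1)
  /\ fps_of_poly (chebW m ^+ 2) * once_series (2 * m + 2) =
     fps_of_poly ('X^(2 * m + 2) * (chebV m.+1 ^+ 2
         + 2%:R * 'X * chebV m * chebV m.+1 - ('X * chebV m) ^+ 2)).
Proof.
pose a k := even_part (avoid_series k.+1); pose b k := odd_part (avoid_series k.+1).
pose c k := even_part (once_series k.+1); pose d k := odd_part (once_series k.+1).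
pose V k := fps_of_poly (chebV k).
have VS k : V k.+2 = V k.+1 - fpsX ^+ 2 * V k.
  by rewrite /V chebVS rmorphB rmorphM rmorphXn.
have a0 : a 0%N = 1 by rewrite /a avoid_series1 even_part1.
have b0 : b 0%N = 0 by rewrite /b avoid_series1 odd_part1.
have c0 : c 0%N = 0.
  by rewrite /c once_series1 -[fpsX]mulr1 even_partX odd_part1 mulr0.
have d0 : d 0%N = fpsX.
  by rewrite /d once_series1 -[fpsX]mulr1 odd_partX even_part1.
have aS k : a k.+1 = 1 + fpsX * (b k * a k.+1 - a k * b k.+1).
  by rewrite [LHS]/a avoid_seriesS even_partD even_part1 even_partX twist_odd_part.
have bS k : b k.+1 = fpsX * (a k * a k.+1 + b k * b k.+1).
  rewrite [LHS]/b avoid_seriesS odd_partD odd_part1 odd_partX add0r.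
  by rewrite twist_even_part.
have cS k : c k.+1 =
    fpsX * (d k * a k.+1 - c k * b k.+1) + fpsX * (b k * c k.+1 - a k * d k.+1).
  by rewrite [LHS]/c once_seriesS even_partD !even_partX !twist_odd_part.
have dS k : d k.+1 =
    fpsX * (c k * a k.+1 + d k * b k.+1) + fpsX * (a k * c k.+1 + b k * d k.+1).
  by rewrite [LHS]/d once_seriesS odd_partD !odd_partX !twist_even_part.
have Dreg k : GRing.lreg ((1 - fpsX * b k) ^+ 2 + (fpsX * a k) ^+ 2).
  have e0 : (1 - fpsX * b k) 0%N = 1.
    rewrite -[LHS]/((1 : {poly rat})`_0 - (fpsX * b k) 0%N).
    by rewrite fpsXM0 subr0 coef1.
  apply: fps_lreg; rewrite fpsDE !expr2 (fps_mul0 (1 - _)) e0.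
  by rewrite fps_mul0 fpsXM0 mulr0 mulr1 addr0.
have Vreg k : GRing.lreg (V k) by apply/fps_of_poly_lreg/chebV_coef0.
have WE k : fps_of_poly (chebW k) = V k.+1 ^+ 2 + (fpsX * V k) ^+ 2.
  by rewrite rmorphD !rmorphXn rmorphM.
have Wreg k : GRing.lreg (V k.+1 ^+ 2 + (fpsX * V k) ^+ 2).
  by rewrite -WE; apply/fps_of_poly_lreg/chebW_coef0.
have V0 : V 0%N = 1 by rewrite /V rmorph1.
have V1 : V 1%N = 1 by rewrite /V rmorph1.
have [[_ _ c_odd d_odd] [_ _ c_even d_even]] :=
  shapes V0 V1 VS a0 b0 c0 d0 aS bS cS dS Dreg Vreg Wreg m.
split.
  rewrite addn1 -(even_odd_part (once_series _)) -/(c _) -/(d _).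
  by rewrite c_odd add0r rmorphXn d_odd rmorphXn addn1.
rewrite addn2 -(even_odd_part (once_series _)) -/(c _) -/(d _) rmorphXn /= WE mulrDr.
rewrite c_even d_even rmorphM rmorphXn rmorphB rmorphD !rmorphXn !rmorphM.
rewrite rmorph_nat /= -/(V _) -/(V m.+1) -/fpsX addn2.
ring.
Qed.

(** At t = 1/(2y) the recurrence of U_m reads U_(m+2) = U_(m+1)/y - U_m; multiply
it by y^(m+2). *)
Lemma chebU_chebV (F : fieldType) (y : F) (V : nat -> F) :
    2%:R != 0 :> F -> y != 0 -> V 0%N = 1 -> V 1%N = 1 ->
    (forall m, V m.+2 = V m.+1 - y ^+ 2 * V m) ->
  forall m, (chebU F m).[1 / (2%:R * y)] = V m / y ^+ m.
Proof.
move=> h2 hy V0 V1 VS m; set u := 1 / _.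
have hu : u *+ 2 = y^-1 by rewrite /u; field; rewrite hy h2.
suff : (chebU F m).[u] = V m / y ^+ m /\
       (chebU F m.+1).[u] = V m.+1 / y ^+ m.+1 by case.
elim: m => [|m [IH1 IH2]].
  by rewrite /= hornerC hornerMn hornerX hu V0 V1 divr1 mul1r.
split=> //; rewrite [chebU F m.+2]/('X *+ 2 * chebU F m.+1 - chebU F m).
rewrite hornerD hornerN hornerM hornerMn hornerX hu IH1 IH2 VS !exprS.
by field; rewrite expf_neq0 ?hy.
Qed.

Lemma chebR_chebV (F : fieldType) (y : F) (V : nat -> F) :
    2%:R != 0 :> F -> y != 0 -> V 0%N = 1 -> V 1%N = 1 ->
    (forall m, V m.+2 = V m.+1 - y ^+ 2 * V m) ->
  forall m, V m.+1 != 0 -> chebR m.+1 y = V m / V m.+1.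
Proof.
move=> h2 hy V0 V1 VS m Vm1; have UV := chebU_chebV h2 hy V0 V1 VS.
rewrite /chebR [m.+1.-1]/= !UV exprS; field.
by rewrite Vm1 hy expf_neq0.
Qed.

(** With v = V_m, this and the next lemma put the two closed forms, after the
substitutions [chebU_chebV] and [chebR_chebV], over the denominators of
[once_series_rational]. *)
Lemma odd_fraction (F : fieldType) (y v : F) m : y != 0 -> v != 0 ->
  y / (v / y ^+ m) ^+ 2 = y ^+ (2 * m + 1) / v ^+ 2.
Proof.
move=> y0 v0; rewrite addn1 (exprS y) mulnC (exprM y).
by field; rewrite v0 expf_neq0.
Qed.

Lemma even_fraction (F : fieldType) (y v v1 : F) m :
    y != 0 -> v != 0 -> v1 != 0 -> v1 ^+ 2 + (y * v) ^+ 2 != 0 ->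
  y ^+ 2 * (v / v1) ^+ 2 /
     ((1 + y ^+ 2 * (v / v1) ^+ 2) ^+ 2 * (v / y ^+ m) ^+ 2)
   * (1 + 2%:R * y * (v / v1) - y ^+ 2 * (v / v1) ^+ 2)
  = y ^+ (2 * m + 2) * (v1 ^+ 2 + 2%:R * y * v * v1 - (y * v) ^+ 2)
    / (v1 ^+ 2 + (y * v) ^+ 2) ^+ 2.
Proof.
move=> y0 v0 v10 w0; rewrite addnC exprD mulnC (exprM y).
field; rewrite ?expf_neq0 ?v0 ?v10 //=.
by move: w0; rewrite exprMn => ->.
Qed.

Theorem theorem3p5 (m : nat) :
  expands (Mgf (incr_pattern (2 * m + 1)) 1)
    (ratx / (chebU ratfun m).[1 / (2%:R * ratx)] ^+ 2)
  /\
  expands (Mgf (incr_pattern (2 * m + 2)) 1)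
    (ratx ^+ 2 * chebR m.+1 ratx ^+ 2 /
       ((1 + ratx ^+ 2 * chebR m.+1 ratx ^+ 2) ^+ 2
        * (chebU ratfun m).[1 / (2%:R * ratx)] ^+ 2)
     * (1 + 2%:R * ratx * chebR m.+1 ratx - ratx ^+ 2 * chebR m.+1 ratx ^+ 2)).
Proof.
have coef_neq0 (p : {poly rat}) : p`_0 = 1 -> p != 0.
  by move=> p0; apply: contra_eq_neq p0 => ->; rewrite coef0 eq_sym oner_eq0.
have V_neq0 k : chebV k != 0 by apply/coef_neq0/chebV_coef0.
have W_neq0 k : chebW k != 0 by apply/coef_neq0/chebW_coef0.
pose V k : ratfun := tofrac (chebV k).
have x_neq0 : ratx != 0 by rewrite /ratx tofrac_eq0 polyX_eq0.
have two_neq0 : 2%:R != 0 :> ratfun.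
  rewrite -(rmorph_nat (@tofrac {poly rat})) tofrac_eq0 -polyC_natr polyC_eq0.
  by rewrite Num.Theory.pnatr_eq0.
have VS k : V k.+2 = V k.+1 - ratx ^+ 2 * V k.
  by rewrite /V chebVS rmorphB rmorphM rmorphXn.
have V0 : V 0%N = 1 by rewrite /V rmorph1.
have V1 : V 1%N = 1 by rewrite /V rmorph1.
have UV := chebU_chebV two_neq0 x_neq0 V0 V1 VS.
have V_frac_neq0 k : V k != 0 by rewrite /V tofrac_eq0.
have RV := chebR_chebV two_neq0 x_neq0 V0 V1 VS (V_frac_neq0 m.+1).
have W0 : V m.+1 ^+ 2 + (ratx * V m) ^+ 2 != 0.
  by rewrite /ratx /V -!(rmorphM, rmorphXn, rmorphD) tofrac_eq0; apply: W_neq0.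
have M k : Mgf (incr_pattern k) 1 =1 once_series k.
  by move=> n; apply: Mgf_signed_count.
have ext (q p : {poly rat}) k : fps_of_poly q * once_series k = fps_of_poly p ->
   series_mul (series_of_poly q) (Mgf (incr_pattern k) 1) =1 series_of_poly p.
  move=> e n; rewrite -[RHS](congr1 (@^~ n) e).
  by apply: eq_bigr => i _; rewrite M.
have [rat1 rat2] := once_series_rational m.
split.
  exists 'X^(2 * m + 1), (chebV m ^+ 2); split; last exact: ext.
    by rewrite expf_neq0.
  rewrite UV (odd_fraction m x_neq0 (V_frac_neq0 m)).
  by rewrite (rmorphXn _ (2 * m + 1)) (rmorphXn _ 2).
eexists _, _; split; last exact: ext rat2; first by rewrite expf_neq0.
rewrite UV RV (even_fraction m x_neq0 (V_frac_neq0 m) (V_frac_neq0 m.+1) W0).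
congr (_ / _).
  by rewrite rmorphM rmorphXn rmorphB rmorphD !rmorphXn !rmorphM rmorph_nat.
by rewrite rmorphXn rmorphD !rmorphXn rmorphM.
Qed.
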